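(* Let $W$ be a channel from $\mathcal X$ to $\mathcal Y$. For every integer $M>0$, every real $C>0$ and every probability distribution $p$ on $\mathcal X$, there exists a resolvability code $\Psi$ with $|\Psi|=M$ and $$\epsilon(\Psi,W_p)\le 2\delta_{p,W,C}+\sqrt{\frac{\delta'_{p,W,C}}{M}},$$ and moreover $\delta'_{p,W,C}\le C$. If $\mathcal Y$ is finite, then for every $t$ with $-\tfrac12\le t<0$ there exists a resolvability code $\Psi'$ with $|\Psi'|=M$ and $$D(\Psi',W_p)\le\frac{\log\big(1+M^te^{\phi(t|W,p)}\big)}{-t},$$ and there exists a resolvability code $\Psi''$ with $|\Psi''|=M$ and $$D(\Psi'',W_p)\le\eta(\delta_{p,W,C})+\delta_{p,W,C}\log|\mathcal Y|+\frac{\delta'_{p,W,C}}{M}.$$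
   Context: A channel $W$ from a finite or countable set $\mathcal X$ to a finite or countable set $\mathcal Y$ is a map $x\mapsto W_x$ assigning a probability distribution $W_x$ on $\mathcal Y$; $W_p(y):=\sum_x p(x)W_x(y)$. A resolvability code $\Psi$ of size $|\Psi|=M$ is a tuple $(x_1,\dots,x_M)$ of elements of $\mathcal X$; its performance measures are $\epsilon(\Psi,W_p):=\sum_y\big|\frac1M\sum_{i=1}^MW_{x_i}(y)-W_p(y)\big|$ and $D(\Psi,W_p):=D\big(\frac1M\sum_{i=1}^MW_{x_i}\,\big\|\,W_p\big)$, where $D(q\|r)=\sum_y q(y)\log\frac{q(y)}{r(y)}$. Define $\delta_{p,W,C}:=\sum_x p(x)\sum_{y:\,W_x(y)>C\,W_p(y)}W_x(y)$, $\delta'_{p,W,C}:=\sum_x p(x)\sum_{y:\,W_x(y)\le C\,W_p(y),\,W_p(y)>0}\frac{W_x(y)^2}{W_p(y)}$, $\phi(t|W,p):=\log\sum_y\big(\sum_x p(x)W_x(y)^{1/(1+t)}\big)^{1+t}$, and $\eta(x):=-x\log x$. *)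

(* Defs.v *)
From HB Require Import structures.
From mathcomp Require Import all_boot all_order all_algebra.
From mathcomp Require Import all_classical all_reals all_analysis.
Set Implicit Arguments. Unset Strict Implicit. Unset Printing Implicit Defensive.
Import Order.TTheory GRing.Theory Num.Theory.
Local Open Scope classical_set_scope.
Local Open Scope ring_scope.
Local Open Scope ereal_scope.

Section Defs.
Context {R : realType} {X Y : countType}.

Definition psum (T : countType) (f : T -> R) : \bar R :=
  \esum_(x in [set: T]) (f x)%:E.

Definition is_distr (T : countType) (p : T -> R) : Prop :=
  (forall x, (0 <= p x)%R) /\ psum p = 1.

Definition is_channel (W : X -> Y -> R) : Prop := forall x, is_distr (W x).

Definition Wp (W : X -> Y -> R) (p : X -> R) (y : Y) : R :=
  fine (psum (fun x => p x * W x y)%R).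

Definition code_out (M : nat) (W : X -> Y -> R) (Psi : 'I_M -> X) (y : Y) : R :=
  ((M%:R)^-1 * \sum_(i < M) W (Psi i) y)%R.

Definition eps_code (M : nat) (W : X -> Y -> R) (p : X -> R) (Psi : 'I_M -> X)
  : \bar R :=
  psum (fun y => `|code_out W Psi y - Wp W p y|%R).

(* relative entropy D(q || r) with natural log and usual conventions
   0 log (0/r) = 0, q log (q/0) = +oo for q > 0; sum over a finite Y *)
Definition KL (q r : Y -> R) : \bar R :=
  \sum_(y \in [set: Y])
     (if q y == 0%R then 0
      else if r y == 0%R then +oo
      else (q y * ln (q y / r y))%:E).

Definition D_code (M : nat) (W : X -> Y -> R) (p : X -> R) (Psi : 'I_M -> X)
  : \bar R := KL (code_out W Psi) (Wp W p).

Definition delta (W : X -> Y -> R) (p : X -> R) (C : R) : \bar R :=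
  \esum_(x in [set: X])
     ((p x)%:E * \esum_(y in [set y | (C * Wp W p y < W x y)%R]) (W x y)%:E).

Definition delta' (W : X -> Y -> R) (p : X -> R) (C : R) : \bar R :=
  \esum_(x in [set: X])
     ((p x)%:E * \esum_(y in [set y | (W x y <= C * Wp W p y)%R /\ (0 < Wp W p y)%R])
                    (W x y ^+ 2 / Wp W p y)%:E).

Definition phi (W : X -> Y -> R) (p : X -> R) (t : R) : R :=
  ln (\sum_(y \in [set: Y])
        (fine (psum (fun x => p x * W x y `^ (1 / (1 + t))))) `^ (1 + t))%R.

End Defs.

Definition eta_ent {R : realType} (x : R) : R := (- x * ln x)%R.

(* Main.v *)
Require Import Defs.
From HB Require Import structures.
From mathcomp Require Import all_boot all_order all_algebra.
From mathcomp Require Import finmap all_classical all_reals all_analysis.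
From mathcomp Require Import ring lra.
Import Order.TTheory GRing.Theory Num.Theory.
Local Open Scope classical_set_scope.
Local Open Scope ring_scope.

(* Random coding: the [n] codewords are drawn independently from [p], and a code
   no worse than the average exists.  Expectations are iterated countable sums
   of non-negative extended reals, so that no integrability has to be tracked.

   Variational distance: [W] is split at the level [C W_p].  The part above
   contributes at most [2 delta] by the triangle inequality; the part below has
   variance at most [E W^2 / n], and its first moment is controlled by
   [|z| <= z^2 / (2 b) + b / 2] with [b] proportional to [W_p y], which sums to
   [sqrt (delta' / n)] after optimising the proportionality factor.

   Divergence: replacing, by concavity of the logarithm, all codewords but one
   by their mean, the expected divergence is at most
   [sum_y E (W ln ((W + (n - 1) W_p) / (n W_p)))].  With [s = - t] the bound by
   [phi] follows from [ln (1 + u) <= ln (1 + u^s) / s], Jensen's and Hoelder's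
   inequalities.  For the last bound the logarithm is at most [W / (n W_p)]
   below the level [C W_p] and at most [- ln W_p] above it, and the entropy of a
   mass [delta] spread over [Y] is at most [eta delta + delta ln |Y|]. *)

(** * Expectation over independent samples *)

Section Esum.
Context {R : realType} {T : choiceType}.
Implicit Types (a : T -> \bar R) (c : R) (D : set T).
Local Open Scope ereal_scope.

(** Comparing finite partial sums gives one inequality for every non-negative factor; the other is
    the same inequality used with [c^-1]. Infinite values of [a] are allowed. *)
Lemma esumZl D c a : (0 <= c)%R -> (forall i, 0 <= a i) ->
  \esum_(i in D) (c%:E * a i) = c%:E * \esum_(i in D) a i.
Proof.
have le (d : R) (b : T -> \bar R) : (0 <= d)%R -> (forall i, 0 <= b i) ->
    \esum_(i in D) (d%:E * b i) <= d%:E * \esum_(i in D) b i.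
  move=> d0 b0; apply: ge_ereal_sup => _ [F FD <-].
  rewrite -ge0_mule_fsumr//; apply: lee_wpmul2l; first by rewrite lee_fin.
  by apply: ereal_sup_ubound; exists F.
move=> + a0; rewrite le_eqVlt => /predU1P[<-|c0].
  by rewrite mul0e esum1// => i _; rewrite mul0e.
apply/eqP; rewrite eq_le (le _ _ (ltW c0) a0) andTb.
have -> : \esum_(i in D) a i = \esum_(i in D) (c^-1%:E * (c%:E * a i)).
  by apply: eq_esum => i _; rewrite muleA -EFinM mulVf ?gt_eqF// mul1e.
rewrite -lee_pdivlMl//; apply: le; first by rewrite invr_ge0 ltW.
by move=> i; rewrite mule_ge0// lee_fin ltW.
Qed.

(** Both sides are a single sum over pairs, reindexed by the swap of coordinates. *)
Lemma esum_exchange (T' : choiceType) (a : T -> T' -> \bar R) :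
  (forall i j, 0 <= a i j) ->
  \esum_(i in [set: T]) \esum_(j in [set: T']) a i j =
  \esum_(j in [set: T']) \esum_(i in [set: T]) a i j.
Proof.
move=> a0; rewrite !(@esum_esum _ _ _ setT (fun=> setT))//.
rewrite (reindex_esum ([set: T'] `*`` (fun=> [set: T]))
  ([set: T] `*`` (fun=> [set: T'])) (fun x => (x.2, x.1)))//; split=> //=.
- by move=> [i j] [i' j'] _ _ /= [-> ->].
- by move=> [i j] _; exists (j, i).
Qed.

Lemma le_esum_term (a : T -> \bar R) x : (forall i, 0 <= a i) ->
  a x <= \esum_(i in [set: T]) a i.
Proof.
move=> a0; apply: esum_ge; exists [set x]; last by rewrite fsbig_set1.
by split => //; exact: finite_set1.
Qed.

End Esum.

(** * Expectations of one letter and of a list of independent letters *)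

Section Mean.
Context {R : realType} {X : countType} (p : X -> R).
Hypothesis p_distr : is_distr p.
Implicit Types (f g : X -> \bar R) (h k : X -> R) (n : nat).
Local Open Scope ereal_scope.

Definition mean f : \bar R := \esum_(x in [set: X]) ((p x)%:E * f x).

Let p_ge0 x : (0 <= p x)%R. Proof. by case: p_distr. Qed.

Let pE_ge0 x : 0 <= (p x)%:E. Proof. by rewrite lee_fin. Qed.

Lemma mean_ge0 f : (forall x, 0 <= f x) -> 0 <= mean f.
Proof. by move=> f0; apply: esum_ge0 => x _; exact: mule_ge0. Qed.

(** Off the support of [p] the convention [0 * +oo = 0] removes the term, so the comparison is asked
    only where [p] is positive. *)
Lemma le_mean f g : (forall x, (0 < p x)%R -> f x <= g x) -> mean f <= mean g.
Proof.
move=> fg; apply: le_esum => x _.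
have := p_ge0 x; rewrite le_eqVlt => /predU1P[<-|px]; first by rewrite !mul0e.
by apply: lee_wpmul2l => //; exact: fg.
Qed.

Lemma eq_mean f g : (forall x, (0 < p x)%R -> f x = g x) -> mean f = mean g.
Proof.
by move=> fg; apply/eqP; rewrite eq_le !le_mean// => x /fg ->.
Qed.

Lemma meanD f g : (forall x, 0 <= f x) -> (forall x, 0 <= g x) ->
  mean (fun x => f x + g x) = mean f + mean g.
Proof.
move=> f0 g0; rewrite /mean -esumD; [|by move=> *; exact: mule_ge0..].
by apply: eq_esum => x _; rewrite ge0_muleDr.
Qed.

Lemma meanZl c f : (0 <= c)%R -> (forall x, 0 <= f x) ->
  mean (fun x => c%:E * f x) = c%:E * mean f.
Proof.
move=> c0 f0; rewrite /mean -esumZl//; last by move=> x; exact: mule_ge0.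
by apply: eq_esum => x _; rewrite muleCA.
Qed.

Lemma mean_cst c : (0 <= c)%R -> mean (fun=> c%:E) = c%:E.
Proof.
move=> c0; rewrite /mean; under eq_esum do rewrite muleC.
by rewrite esumZl//; case: p_distr => _ ps; rewrite -[esum _ _]/(psum p) ps mule1.
Qed.

Lemma mean_esum (Y : choiceType) (f : X -> Y -> \bar R) :
  (forall x y, 0 <= f x y) ->
  mean (fun x => \esum_(y in [set: Y]) f x y) =
  \esum_(y in [set: Y]) mean (f ^~ y).
Proof.
move=> f0; rewrite /mean -esum_exchange; last by move=> *; exact: mule_ge0.
by apply: eq_esum => x _; rewrite esumZl.
Qed.

Lemma support_nonempty : exists x, (0 < p x)%R.
Proof.
apply: contrapT => /forallNP p0.
have := mean_cst 1%R ler01; rewrite (@eq_mean _ (fun=> 0)) ?mean_cst//.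
  by move=> /eqP; rewrite eqe eq_sym oner_eq0.
by move=> x /p0.
Qed.

(** Some value does not exceed the average. As [f] may be infinite, the contradiction comes from a
    strict margin at one point of the support. *)
Lemma mean_ex f b : (forall x, 0 <= f x) -> mean f <= b%:E ->
  exists2 x, (0 < p x)%R & f x <= b%:E.
Proof.
move=> f0 fb; apply: contrapT => /forall2NP nfb.
have bf x : (0 < p x)%R -> b%:E < f x by case: (nfb x) => // /negP; rewrite -ltNge.
have b0 : (0 <= b)%R by rewrite -lee_fin (le_trans _ fb)// mean_ge0.
have [x0 px0] := support_nonempty.
(* A margin above [b] at [x0]; any positive number will do if [f x0] is infinite. *)
have [e e0 ef] : exists2 e : R, (0 < e)%R & (b + e)%:E <= f x0.
  case: (f x0) (bf _ px0) => [r||]//.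
    by rewrite lte_fin => br; exists (r - b)%R; rewrite ?subr_gt0// subrKC.
  by move=> _; exists 1%R; rewrite ?leey.
(* This minorant of [f] on the support has mean at least [b + e * p x0], which exceeds [b]. *)
have : mean (fun x => b%:E + (e * (x == x0)%:R)%:E) <= b%:E.
  apply: le_trans fb; apply: le_mean => x px.
  have [->|xx0] := eqVneq x x0; first by rewrite mulr1.
  by rewrite mulr0 adde0 ltW// bf.
rewrite meanD ?mean_cst//; last by move=> x; rewrite lee_fin mulr_ge0// ltW.
apply/negP; rewrite -ltNge lteDl//.
apply: lt_le_trans (le_esum_term (fun x => (p x)%:E * (e * (x == x0)%:R)%:E) x0 _).
  by rewrite eqxx mulr1 mule_gt0.
by move=> x; rewrite mule_ge0// lee_fin mulr_ge0// ltW.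
Qed.

(** [fine] sends an infinite mean to 0, so this is the expectation only under a finiteness bound, as
    in [rmeanE] and [rmean_bounded]. *)
Definition rmean h : R := fine (mean (EFin \o h)).

Lemma rmeanE h c : (forall x, 0 <= h x)%R -> mean (EFin \o h) <= c%:E ->
  mean (EFin \o h) = (rmean h)%:E.
Proof.
move=> h0 hc; rewrite fineK// fin_real// (lt_le_trans (ltNyr 0)) ?mean_ge0//=.
by rewrite (le_lt_trans hc)// ltry.
Qed.

Lemma rmean_bounded h : (forall x, 0 <= h x <= 1)%R ->
  mean (EFin \o h) = (rmean h)%:E.
Proof.
move=> h01; apply: (@rmeanE _ 1%R) => [x|]; first by case/andP: (h01 x).
rewrite -(mean_cst 1%R)//; apply: le_mean => x _.
by rewrite lee_fin; case/andP: (h01 x).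
Qed.

(** Expectation under the [n]-fold product of [p], written as nested sums; taking [F] on lists
    allows induction on [n] without product measures. *)
Fixpoint imean n (F : seq X -> \bar R) : \bar R :=
  if n is n'.+1 then mean (fun x => imean n' (fun s => F (x :: s))) else F [::].

Definition ssum h (s : seq X) : R := (\sum_(x <- s) h x)%R.

Lemma ssum_ge0 h s : (forall x, 0 <= h x)%R -> (0 <= ssum h s)%R.
Proof. by move=> h0; exact: sumr_ge0. Qed.

Lemma ssum_cons h x s : ssum h (x :: s) = (h x + ssum h s)%R.
Proof. exact: big_cons. Qed.

Lemma imean_ge0 n F : (forall s, 0 <= F s) -> 0 <= imean n F.
Proof.
by elim: n F => [|n IH] F F0 //=; apply: mean_ge0 => x; exact: IH.
Qed.

Lemma le_imean n F G :
  (forall s, size s = n -> all (fun x => 0 < p x)%R s -> F s <= G s) ->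
  imean n F <= imean n G.
Proof.
elim: n F G => [|n IH] F G FG /=; first exact: FG.
apply: le_mean => x px; apply: IH => s sn ps.
by apply: FG; rewrite /= ?sn ?px.
Qed.

Lemma eq_imean n F G :
  (forall s, size s = n -> all (fun x => 0 < p x)%R s -> F s = G s) ->
  imean n F = imean n G.
Proof.
by move=> FG; apply/eqP; rewrite eq_le !le_imean// => s sn ps; rewrite FG.
Qed.

Lemma imeanD n F G : (forall s, 0 <= F s) -> (forall s, 0 <= G s) ->
  imean n (fun s => F s + G s) = imean n F + imean n G.
Proof.
elim: n F G => [|n IH] F G F0 G0 //=.
rewrite -meanD; [|by move=> x; exact: imean_ge0..].
by apply: eq_mean => x _; rewrite IH.
Qed.

Lemma imeanZl n c F : (0 <= c)%R -> (forall s, 0 <= F s) ->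
  imean n (fun s => c%:E * F s) = c%:E * imean n F.
Proof.
move=> c0; elim: n F => [|n IH] F F0 //=.
rewrite -meanZl//; last by move=> x; exact: imean_ge0.
by apply: eq_mean => x _; rewrite IH.
Qed.

Lemma imean_cst n c : (0 <= c)%R -> imean n (fun=> c%:E) = c%:E.
Proof.
move=> c0; elim: n => [|n IH] //=.
by rewrite -[RHS]mean_cst//; apply: eq_mean => x _.
Qed.

Lemma imean_esum (Y : choiceType) n (F : seq X -> Y -> \bar R) :
  (forall s y, 0 <= F s y) ->
  imean n (fun s => \esum_(y in [set: Y]) F s y) =
  \esum_(y in [set: Y]) imean n (F ^~ y).
Proof.
elim: n F => [|n IH] F F0 //=.
rewrite -mean_esum; last by move=> x y; exact: imean_ge0.
by apply: eq_mean => x _; rewrite IH.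
Qed.

(** The random coding step: [mean_ex] picks the letters one after the other. Their positive
    probability is kept because finiteness of the divergence depends on it. *)
Lemma imean_ex n F b : (forall s, 0 <= F s) -> imean n F <= b%:E ->
  exists s : n.-tuple X, all (fun x => 0 < p x)%R s /\ F s <= b%:E.
Proof.
move=> F0 Fb.
have [s [sn ps Fs]] : exists s, [/\ size s = n, all (fun x => 0 < p x)%R s
    & F s <= b%:E].
  elim: n F F0 Fb => [|n IH] F F0 Fb; first by exists [::].
  have [x px /IH[//|s [sn ps Fs]]] := mean_ex _ _ (fun x => imean_ge0 n _ (fun s => F0 (x :: s))) Fb.
  by exists (x :: s); rewrite /= sn px ps.
by exists (Tuple (introT eqP sn)).
Qed.

Lemma imean_ssum n h m : (forall x, 0 <= h x)%R -> mean (EFin \o h) = m%:E ->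
  imean n (EFin \o ssum h) = (n%:R * m)%:E.
Proof.
move=> h0 hm; have m0 : (0 <= m)%R by rewrite -lee_fin -hm mean_ge0.
elim: n => [|n IH] /=; first by rewrite /ssum big_nil mul0r.
transitivity (mean (fun x => (h x)%:E + (n%:R * m)%:E)).
  apply: eq_mean => x _; rewrite -IH -(imean_cst n (h x))// -imeanD.
  - by apply: eq_imean => s _ _; rewrite /= ssum_cons EFinD.
  - by move=> s; rewrite lee_fin.
  - by move=> s; rewrite lee_fin ssum_ge0.
rewrite meanD ?hm ?mean_cst ?mulr_ge0// ?lee_fin ?mulr_ge0//.
by rewrite -EFinD -natr1 mulrDl mul1r addrC.
Qed.

(** In the product of the two sums the [n] diagonal pairs each have mean [c], and the [n (n - 1)]
    pairs of independent letters each have mean [mh * mk]. *)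
Lemma imean_ssumM n h k mh mk c :
  (forall x, 0 <= h x)%R -> (forall x, 0 <= k x)%R ->
  mean (EFin \o h) = mh%:E -> mean (EFin \o k) = mk%:E ->
  mean (fun x => (h x * k x)%:E) = c%:E ->
  imean n (fun s => (ssum h s * ssum k s)%:E) =
  (n%:R * c + n%:R * (n%:R - 1) * mh * mk)%:E.
Proof.
move=> h0 k0 hm km hkc.
have mh0 : (0 <= mh)%R by rewrite -lee_fin -hm mean_ge0.
have mk0 : (0 <= mk)%R by rewrite -lee_fin -km mean_ge0.
elim: n => [|n IH] /=; first by rewrite /ssum !big_nil !mul0r addr0.
have I0 : (0 <= n%:R * c + n%:R * (n%:R - 1) * mh * mk)%R.
  rewrite -lee_fin -IH; apply: imean_ge0 => s.
  by rewrite lee_fin mulr_ge0 ?ssum_ge0.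
(* Expansion of [(h x + ssum h s) * (k x + ssum k s)], with [x] the first letter and the average
   over [s] already taken. *)
transitivity (mean (fun x => (h x * k x)%:E + (n%:R * mk)%:E * (h x)%:E
    + (n%:R * mh)%:E * (k x)%:E + (n%:R * c + n%:R * (n%:R - 1) * mh * mk)%:E)).
  apply: eq_mean => x _.
  rewrite -IH -(imean_cst n (h x * k x)%R) ?mulr_ge0// (muleC _ (h x)%:E)
    (muleC _ (k x)%:E) -(imean_ssum n k mk)// -(imean_ssum n h mh)//.
  rewrite -!imeanZl//; [|by move=> s; rewrite lee_fin ssum_ge0..].
  rewrite -!imeanD//; try by move=> s; rewrite -?EFinM -?EFinD lee_fin;
    rewrite ?addr_ge0// ?mulr_ge0// ?ssum_ge0.
  apply: eq_imean => s _ _ /=; rewrite !ssum_cons -!EFinM -!EFinD; congr _%:E.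
  by ring.
rewrite !meanD ?mean_cst//; try by move=> x; rewrite -?EFinM -?EFinD lee_fin;
  rewrite ?addr_ge0// ?mulr_ge0// ?ssum_ge0.
rewrite !meanZl ?mulr_ge0//= hkc hm km -!EFinM -!EFinD -natr1; congr _%:E.
by ring.
Qed.

End Mean.

(** * Scalar inequalities *)

Section Scalar.
Context {R : realType}.
Implicit Types (b q s u w x z : R).

Lemma ln_le_subr1 x : 0 < x -> ln x <= x - 1.
Proof. by move=> x0; rewrite -{1}[x](subrKC 1) le_ln1Dx// ltrBrDl subrr. Qed.

Lemma ln_tangent x z : 0 < x -> 0 < z -> ln z <= ln x + (z / x - 1).
Proof.
move=> x0 z0; rewrite -lerBlDl -ln_div ?posrE//.
by apply: ln_le_subr1; rewrite divr_gt0.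
Qed.

Lemma norm_le_sqr z b : 0 < b -> `|z| <= z ^+ 2 / (2 * b) + b / 2.
Proof.
move=> b0; rewrite -[z ^+ 2]real_normK ?num_real//; move: `|z| => v.
(* The gap between the two sides is a square. *)
have -> : v ^+ 2 / (2 * b) + b / 2 = v + (v - b) ^+ 2 / (2 * b).
  by field; rewrite gt_eqF.
by rewrite lerDl divr_ge0 ?sqr_ge0// mulr_ge0// ltW.
Qed.

(** The summand of the divergence with [w - q] added: this correction sums to 0 for two
    distributions and makes each term non-negative. *)
Definition kl_term q w : R := q * ln (q / w) - q + w.

Lemma kl_term_ge0 q w : 0 <= q -> 0 < w -> 0 <= kl_term q w.
Proof.
rewrite /kl_term le_eqVlt => /predU1P[<- w0|q0 w0].
  by rewrite mul0r subr0 add0r ltW.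
have := ln_tangent _ _ q0 w0; rewrite ln_div ?posrE// => h.
have : q * ln w <= q * (ln q + (w / q - 1)) by rewrite ler_pM2l.
have -> : q * (ln q + (w / q - 1)) = q * ln q + w - q.
  by field; rewrite gt_eqF.
lra.
Qed.

(** After exponentiation this is the subadditivity [(1 + u)^s <= 1 + u^s]. *)
Lemma ln1D_le_powR s u : 0 < s <= 1 -> 0 <= u ->
  ln (1 + u) <= ln (1 + u `^ s) / s.
Proof.
move=> /andP[s0 s1] u0.
have pu0 : 0 < 1 + u by lra.
rewrite ler_pdivlMr// mulrC -ln_powR ler_ln ?posrE ?powR_gt0//; last first.
  by rewrite ltr_pwDl// powR_ge0.
(* The numbers [1 / (1 + u)] and [u / (1 + u)] lie in the unit interval and add up to 1; raising
   them to a power [s <= 1] can only increase them. *)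
have -> : 1 + u `^ s = (1 + u) `^ s * ((1 + u)^-1 `^ s + (u / (1 + u)) `^ s).
  rewrite mulrDr -!powRM ?invr_ge0 ?divr_ge0 ?(ltW pu0)//.
  by rewrite divff ?gt_eqF// powR1 mulrCA divff ?gt_eqF// mulr1.
rewrite ler_peMr ?powR_ge0//.
have e : (1 + u)^-1 + u / (1 + u) = 1 by field; rewrite gt_eqF.
rewrite -[leLHS]e.
apply: lerD; first by rewrite ger1_powR// invr_gt0 pu0 invf_le1//; lra.
move: u0; rewrite le_eqVlt => /predU1P[<-|u0]; first by rewrite mul0r powR_ge0.
by rewrite ger1_powR// divr_gt0//= ler_pdivrMr// mul1r; lra.
Qed.

(** Young's inequality with conjugate exponents [1 / (1 - s)] and [1 / s]. *)
Lemma powR_young x z s : 0 <= x -> 0 <= z -> 0 < s < 1 ->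
  x `^ (1 - s) * z `^ s <= (1 - s) * x + s * z.
Proof.
move=> x0 z0 /andP[s0 s1].
have s1' : 0 < 1 - s by lra.
have := @conjugate_powR _ (x `^ (1 - s)) (z `^ s) (1 - s)^-1 s^-1.
rewrite -!powRrM !mulfV ?gt_eqF// !powRr1// !invrK !invr_gt0 !powR_ge0.
by rewrite (mulrC x) (mulrC z); apply => //; rewrite subrK.
Qed.

End Scalar.

(** * Fluctuations of a sample mean *)

Section SampleMean.
Context {R : realType} {X : countType} (p : X -> R).
Hypothesis p_distr : is_distr p.
Implicit Types (a g : X -> R) (n : nat).
Local Notation mean := (mean p).
Local Notation imean := (imean p).

Lemma imean_deviation n g m q b : (0 < n)%N -> (forall x, 0 <= g x) -> 0 < b ->
  mean (EFin \o g) = m%:E -> mean (fun x => (g x ^+ 2)%:E) = q%:E ->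
  (imean n (fun s => `|n%:R^-1 * ssum g s - m|%:E) <=
    (q / (2 * n%:R * b) + b / 2)%:E)%E.
Proof.
move=> n0 g0 b0 gm gq; have nR0 : 0 < n%:R :> R by rewrite ltr0n.
have m0 : 0 <= m by rewrite -lee_fin -gm (mean_ge0 _ p_distr)// => x; rewrite lee_fin.
have c1 : 0 <= m / (n%:R * b) by rewrite divr_ge0// mulr_ge0// ltW.
have c2 : 0 <= (2 * b * n%:R ^+ 2)^-1 by rewrite invr_ge0 !mulr_ge0 ?ltW.
have c3 : 0 <= m ^+ 2 / (2 * b) + b / 2.
  by rewrite addr_ge0// divr_ge0 ?sqr_ge0 ?mulr_ge0 ?ltW.
(* The square in [norm_le_sqr] is expanded and its negative cross term moved to the left, so that
   only non-negative functions are averaged. *)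
have : (imean n (fun s => `|n%:R^-1 * ssum g s - m|%:E +
      (m / (n%:R * b))%:E * (ssum g s)%:E) <=
    imean n (fun s => (2 * b * n%:R ^+ 2)^-1%:E * (ssum g s * ssum g s)%:E +
      (m ^+ 2 / (2 * b) + b / 2)%:E))%E.
  apply: (le_imean _ p_distr) => s _ _; rewrite -!EFinM -!EFinD lee_fin.
  have := norm_le_sqr (n%:R^-1 * ssum g s - m) b b0; move: `|_| => z zb.
  rewrite -lerBrDr (le_trans zb)// le_eqVlt; apply/orP; left; apply/eqP.
  by field; rewrite !gt_eqF.
have S0 s : 0 <= ssum g s by exact: ssum_ge0.
have SS0 s : 0 <= ssum g s * ssum g s by rewrite mulr_ge0.
rewrite !(imeanD _ p_distr) ?(imeanZl _ p_distr)//; try by move=> s;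
  first [by rewrite lee_fin normr_ge0 
    | by apply: mule_ge0; rewrite lee_fin].
rewrite (imean_cst _ p_distr)// (imean_ssum _ p_distr n g m)//.
have gq' : mean (fun x => (g x * g x)%:E) = q%:E.
  by rewrite -gq; apply: (eq_mean _ p_distr) => x _; rewrite expr2.
rewrite (imean_ssumM _ p_distr n g g m m q)//.
rewrite -!EFinM -!EFinD -leeBrDr// -EFinB => /le_trans; apply; rewrite lee_fin.
(* The exact variance is [(q - m^2) / n]; the bound keeps only [q / n], and this is the gap. *)
rewrite -subr_ge0 (_ : _ - _ = m ^+ 2 / (2 * n%:R * b)); last first.
  by field; rewrite !gt_eqF.
by rewrite divr_ge0 ?sqr_ge0// !mulr_ge0 ?ltW.
Qed.

(* Concavity of the logarithm, in the form of its tangent at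
   [g x + (n - 1) w], replaces the other [n - 1] samples by their mean. *)
Lemma ssum_ln_le n g a w (s : seq X) : 0 < w -> (0 < n)%N ->
  (forall x, 0 <= g x) ->
  (forall x, 0 < p x -> 0 < g x ->
    ln ((g x + (n%:R - 1) * w) / (n%:R * w)) <= a x) ->
  all (fun x => 0 < p x) s ->
  ssum g s * ln (ssum g s / (n%:R * w)) + ssum g s <=
  ssum (fun x => g x * a x) s +
  ssum (fun x => g x / (g x + (n%:R - 1) * w)) s * ssum g s.
Proof.
move=> w0 n0 g0 ga ps; have [S SE] : exists S, S = ssum g s by exists (ssum g s).
have nR0 : 0 < n%:R :> R by rewrite ltr0n.
have nR1 : 1 <= n%:R :> R by rewrite ler1n.
rewrite -SE {1 3}SE /ssum !mulr_suml -!big_split/=.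
rewrite !big_seq; apply: ler_sum => x xs.
have px : 0 < p x by move/allP: ps; apply.
have gS : g x <= S.
  by rewrite SE /ssum (big_rem x)//= lerDl; exact: sumr_ge0.
have := g0 x; rewrite le_eqVlt => /predU1P[<-|gx0]; first by rewrite !mul0r !addr0.
have S0 : 0 < S by exact: lt_le_trans gS.
set G := g x + (n%:R - 1) * w.
have G0 : 0 < G by rewrite /G ltr_wpDr// mulr_ge0 ?subr_ge0 ?(ltW w0).
have := ga _ px gx0; rewrite -/G !ln_div ?posrE ?mulr_gt0// => h1.
have h2 := ln_tangent _ _ G0 S0.
have -> : g x * (ln S - ln (n%:R * w)) + g x =
    g x * (ln S - ln (n%:R * w) + 1) by ring.
have -> : g x * a x + g x / G * S = g x * (a x + S / G) by field; rewrite gt_eqF.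
by rewrite ler_pM2l//; lra.
Qed.

Lemma imean_kl n g a w : 0 < w -> (0 < n)%N ->
  (forall x, 0 <= g x) -> (forall x, 0 <= a x) ->
  (forall x, 0 < p x -> 0 < g x ->
    ln ((g x + (n%:R - 1) * w) / (n%:R * w)) <= a x) ->
  mean (EFin \o g) = w%:E ->
  (imean n (fun s => (kl_term (n%:R^-1 * ssum g s) w)%:E) <=
   mean (fun x => (g x * a x)%:E))%E.
Proof.
move=> w0 n0 g0 a0 ga gw; have nR0 : 0 < n%:R :> R by rewrite ltr0n.
have nR1 : 1 <= n%:R :> R by rewrite ler1n.
have ga0 x : 0 <= g x * a x by rewrite mulr_ge0.
have : (0 <= mean (fun x => (g x * a x)%:E))%E.
  by apply: (mean_ge0 _ p_distr) => x; rewrite lee_fin.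
(* An infinite right-hand side leaves nothing to prove. *)
case E : (mean _) => [c||]//; last by move=> _; rewrite leey.
rewrite lee_fin => c0.
(* Slope of the tangent in [ssum_ln_le], weighted by [g x]. For [n = 1] the denominator can vanish,
   but then [g x = 0] and [BG] still holds. *)
pose B x := g x / (g x + (n%:R - 1) * w).
have G0 x : 0 <= g x + (n%:R - 1) * w by rewrite addr_ge0// mulr_ge0 ?subr_ge0 ?(ltW w0).
have BG x : B x * (g x + (n%:R - 1) * w) = g x.
  have [G0'|G0'] := eqVneq (g x + (n%:R - 1) * w) 0; last by rewrite divfK.
  rewrite G0' mulr0; apply/eqP; rewrite eq_le g0 -G0' lerDl.
  by rewrite mulr_ge0 ?subr_ge0 ?(ltW w0).
have B01 x : 0 <= B x <= 1.
  rewrite /B divr_ge0//=; have := G0 x; rewrite le_eqVlt => /predU1P[<-|G0'].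
    by rewrite invr0 mulr0.
  by rewrite ler_pdivrMr// mul1r lerDl mulr_ge0 ?subr_ge0 ?(ltW w0).
have B0 x : 0 <= B x by case/andP: (B01 x).
have meanB := rmean_bounded _ p_distr _ B01; set mB := rmean p B in meanB.
have mB0 : 0 <= mB by rewrite -lee_fin -meanB (mean_ge0 _ p_distr)// => x; rewrite lee_fin.
have [mBg meanBg] : exists r, mean (fun x => (B x * g x)%:E) = r%:E.
  exists (rmean p (fun x => B x * g x)).
  rewrite -[LHS]/(mean (EFin \o (fun x => B x * g x))).
  apply: (rmeanE _ p_distr _ w) => [x|]; first by rewrite mulr_ge0.
  rewrite -gw; apply: (le_mean _ p_distr) => x _; rewrite lee_fin.
  by case/andP: (B01 x) => _ B1; rewrite ler_piMl.
(* The average of [BG]. With [imean_ssumM] it gives [ssum B s * ssum g s] the mean [n w], so the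
   first-order terms cancel at the end. *)
have mBE : mBg + (n%:R - 1) * w * mB = w.
  have : mean (fun x => (B x * g x)%:E + ((n%:R - 1) * w)%:E * (B x)%:E)%E = w%:E.
    rewrite -gw; apply: (eq_mean _ p_distr) => x _.
    by rewrite -EFinM -EFinD/= -[in RHS]BG mulrDr (mulrC _ (B x)).
  have n1w : 0 <= (n%:R - 1) * w by rewrite mulr_ge0 ?subr_ge0 ?(ltW w0).
  rewrite (meanD _ p_distr) ?(meanZl _ p_distr)// ?meanBg;
    try by move=> x; rewrite -?EFinM lee_fin// mulr_ge0.
  by rewrite -[X in (_ * X)%E]/(mean (EFin \o B)) meanB -EFinM -EFinD => -[].
have S0 s : 0 <= ssum g s by exact: ssum_ge0.
have k0 s : 0 <= kl_term (n%:R^-1 * ssum g s) w.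
  by rewrite kl_term_ge0// mulr_ge0// invr_ge0 ltW.
(* [n] times [kl_term] contains [- ssum g s] where [ssum_ln_le] has [+ ssum g s]; adding twice the
   sum on the left keeps all summands non-negative. *)
have : (imean n (fun s => n%:R%:E * (kl_term (n%:R^-1 * ssum g s) w)%:E +
      2%:E * (ssum g s)%:E) <=
    imean n (fun s => (ssum (fun x => g x * a x) s)%:E +
      ((ssum B s * ssum g s)%:E + (n%:R * w)%:E)))%E.
  apply: (le_imean _ p_distr) => s _ ps; rewrite -!EFinM -!EFinD lee_fin.
  have := ssum_ln_le n g a w s w0 n0 g0 ga ps; rewrite -/B.
  rewrite /kl_term (_ : n%:R^-1 * ssum g s / w = ssum g s / (n%:R * w)); last first.
    by field; rewrite !gt_eqF.
  have -> : n%:R * (n%:R^-1 * ssum g s * ln (ssum g s / (n%:R * w)) -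
      n%:R^-1 * ssum g s + w) =
    ssum g s * ln (ssum g s / (n%:R * w)) - ssum g s + n%:R * w.
    by field; rewrite gt_eqF.
  lra.
have nw0 : 0 <= n%:R * w by rewrite mulr_ge0 ?ltW.
have Sga0 s : 0 <= ssum (fun x => g x * a x) s by exact: ssum_ge0.
have SB0 s : 0 <= ssum B s * ssum g s by rewrite mulr_ge0// ssum_ge0.
rewrite !(imeanD _ p_distr) ?(imeanZl _ p_distr)//; try by move=> s;
  first [by rewrite lee_fin | by apply: adde_ge0; rewrite lee_fin
    | by apply: mule_ge0; rewrite lee_fin].
rewrite (imean_cst _ p_distr)// (imean_ssum _ p_distr n g w)//.
rewrite (imean_ssum _ p_distr n (fun x => g x * a x) c)//.
rewrite (imean_ssumM _ p_distr n B g mB w mBg)//.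
rewrite -!EFinM -!EFinD -leeBrDr// -EFinB -lee_pdivlMl// => /le_trans; apply.
rewrite -EFinM lee_fin ler_pdivrMl//.
have : n%:R * (mBg + (n%:R - 1) * w * mB) = n%:R * w by rewrite mBE.
lra.
Qed.

End SampleMean.

(** * Variational distance *)

Section Channel.
Context {R : realType} {X Y : countType} (W : X -> Y -> R) (p : X -> R).
Hypotheses (W_channel : is_channel W) (p_distr : is_distr p).
Local Notation mean := (mean p).
Local Notation imean := (imean p).
Local Notation w := (Wp W p).

Lemma channel_ge0 x y : 0 <= W x y.
Proof. by case: (W_channel x) => + _; exact. Qed.

Lemma channel_le1 x y : W x y <= 1.
Proof.
case: (W_channel x) => W0 W1; rewrite -lee_fin -[leRHS]W1.
by apply: (le_esum_term (fun y => (W x y)%:E)) => z; rewrite lee_fin.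
Qed.

Lemma channel01 x y : 0 <= W x y <= 1.
Proof. by rewrite channel_ge0 channel_le1. Qed.

(** Entries of the channel are at most 1, so the sum is finite and [fine] in [Wp] loses nothing. *)
Lemma mean_channel y : mean (EFin \o W ^~ y) = (w y)%:E.
Proof.
rewrite (rmean_bounded _ p_distr) => [|x]; last exact: channel01.
by congr (fine _)%:E; apply: eq_esum => x _; rewrite EFinM.
Qed.

Lemma output_ge0 y : 0 <= w y.
Proof.
rewrite -lee_fin -mean_channel (mean_ge0 _ p_distr)// => x.
by rewrite lee_fin channel_ge0.
Qed.

Lemma output_le1 y : w y <= 1.
Proof.
rewrite -lee_fin -mean_channel -(mean_cst _ p_distr 1)//.
by apply: (le_mean _ p_distr) => x _; rewrite lee_fin channel_le1.
Qed.

Lemma output_distr : is_distr w.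
Proof.
split; first exact: output_ge0.
rewrite /psum; under eq_esum do rewrite -mean_channel.
rewrite -(mean_esum _ p_distr _ (fun x y => (W x y)%:E)); last first.
  by move=> x y; rewrite lee_fin channel_ge0.
rewrite -[RHS](mean_cst _ p_distr 1)//; apply: (eq_mean _ p_distr) => x _.
by case: (W_channel x).
Qed.

Lemma output_gt0 x y : 0 < p x -> 0 < W x y -> 0 < w y.
Proof.
move=> px Wx; rewrite -lte_fin -mean_channel.
apply: lt_le_trans (le_esum_term (fun x => ((p x)%:E * (W x y)%:E)%E) x _).
  by rewrite -EFinM lte_fin mulr_gt0.
case: p_distr => p0 _ z; rewrite -EFinM lee_fin mulr_ge0//.
exact: channel_ge0.
Qed.

Lemma code_out_tnth n (s : n.-tuple X) y :
  code_out W (tnth s) y = n%:R^-1 * ssum (W ^~ y) s.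
Proof. by rewrite /code_out /ssum big_tuple. Qed.

(** * Truncation of the channel at the level [C W_p] and the variational bound *)

Section Truncation.
Variable C : R.
Hypothesis C_gt0 : 0 < C.

Definition trunc_hi x y : R := if C * w y < W x y then W x y else 0.
Definition trunc_lo x y : R := if W x y <= C * w y then W x y else 0.

Lemma trunc_hi01 x y : 0 <= trunc_hi x y <= 1.
Proof. by rewrite /trunc_hi; case: ifP; rewrite ?channel01// lexx ler01. Qed.

Lemma trunc_lo01 x y : 0 <= trunc_lo x y <= 1.
Proof. by rewrite /trunc_lo; case: ifP; rewrite ?channel01// lexx ler01. Qed.

Lemma trunc_hi_ge0 x y : 0 <= trunc_hi x y.
Proof. by case/andP: (trunc_hi01 x y). Qed.

Lemma trunc_lo_ge0 x y : 0 <= trunc_lo x y.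
Proof. by case/andP: (trunc_lo01 x y). Qed.

Lemma truncD x y : W x y = trunc_hi x y + trunc_lo x y.
Proof.
by rewrite /trunc_hi /trunc_lo; case: leP; rewrite ?addr0 ?add0r.
Qed.

Definition mass_hi y : R := rmean p (trunc_hi ^~ y).
Definition mass_lo y : R := rmean p (trunc_lo ^~ y).

Lemma mean_trunc_hi y : mean (EFin \o trunc_hi ^~ y) = (mass_hi y)%:E.
Proof. by apply: (rmean_bounded _ p_distr) => x; exact: trunc_hi01. Qed.

Lemma mean_trunc_lo y : mean (EFin \o trunc_lo ^~ y) = (mass_lo y)%:E.
Proof. by apply: (rmean_bounded _ p_distr) => x; exact: trunc_lo01. Qed.

Lemma mass_hi_ge0 y : 0 <= mass_hi y.
Proof.
rewrite -lee_fin -mean_trunc_hi (mean_ge0 _ p_distr)// => x.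
by rewrite lee_fin trunc_hi_ge0.
Qed.

Lemma mass_lo_ge0 y : 0 <= mass_lo y.
Proof.
rewrite -lee_fin -mean_trunc_lo (mean_ge0 _ p_distr)// => x.
by rewrite lee_fin trunc_lo_ge0.
Qed.

Lemma massD y : w y = mass_hi y + mass_lo y.
Proof.
apply: EFin_inj; rewrite EFinD -mean_channel -mean_trunc_hi -mean_trunc_lo.
rewrite -(meanD _ p_distr); [|by move=> x; rewrite lee_fin ?trunc_hi_ge0 ?trunc_lo_ge0..].
by apply: (eq_mean _ p_distr) => x _; rewrite /= -EFinD -truncD.
Qed.

Lemma delta_esum : delta W p C = \esum_(y in [set: Y]) (mass_hi y)%:E.
Proof.
under eq_esum do rewrite -mean_trunc_hi.
rewrite -(mean_esum _ p_distr _ (fun x y => (trunc_hi x y)%:E)); last first.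
  by move=> x y; rewrite lee_fin trunc_hi_ge0.
apply: eq_esum => x _; congr (_ * _)%E; rewrite esum_mkcond.
apply: eq_esum => y _; rewrite /trunc_hi; case: ifPn.
  by rewrite inE /= => ->.
by rewrite notin_setE /= => /negP/negbTE ->.
Qed.

(** Exchange of the two sums. The outputs with [w y = 0], excluded in [delta'], contribute 0 on the
    right because division by zero yields 0. *)
Lemma delta'_esum : delta' W p C =
  \esum_(y in [set: Y]) mean (fun x => (trunc_lo x y ^+ 2 / w y)%:E).
Proof.
rewrite -(mean_esum _ p_distr _ (fun x y => (trunc_lo x y ^+ 2 / w y)%:E)); last first.
  by move=> x y; rewrite lee_fin divr_ge0 ?sqr_ge0 ?output_ge0.
apply: eq_esum => x _; congr (_ * _)%E; rewrite esum_mkcond.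
apply: eq_esum => y _; rewrite /trunc_lo; case: ifPn.
  by rewrite inE /= => -[-> _].
rewrite notin_setE /=; case: ifP => Wx; last by rewrite expr0n/= mul0r.
move=> /not_andP[//|/negP]; rewrite -leNgt => w0.
have -> : w y = 0 by apply/eqP; rewrite eq_le w0 output_ge0.
by rewrite invr0 mulr0.
Qed.

Lemma delta_le1 : (delta W p C <= 1)%E.
Proof.
case: output_distr => _ <-; rewrite delta_esum; apply: le_esum => y _.
by rewrite lee_fin massD lerDl mass_lo_ge0.
Qed.

Lemma delta_ge0 : (0 <= delta W p C)%E.
Proof.
by rewrite delta_esum; apply: esum_ge0 => y _; rewrite lee_fin mass_hi_ge0.
Qed.

Lemma delta'_ge0 : (0 <= delta' W p C)%E.
Proof.
rewrite delta'_esum; apply: esum_ge0 => y _.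
apply: (mean_ge0 _ p_distr) => x.
by rewrite lee_fin divr_ge0 ?sqr_ge0 ?output_ge0.
Qed.

(** Below the level, [W^2 / w <= C W] termwise, and [C W] has total mean [C]. *)
Lemma delta'_le : (delta' W p C <= C%:E)%E.
Proof.
have [w0 w1] := output_distr.
have -> : C%:E = (\esum_(y in [set: Y]) (C%:E * (w y)%:E))%E.
  by rewrite esumZl ?(ltW C_gt0)// -[X in (_ * X)%E]/(psum w) w1 mule1.
rewrite delta'_esum; apply: le_esum => y _.
rewrite -mean_channel -(meanZl _ p_distr) ?(ltW C_gt0)//; last first.
  by move=> x; rewrite lee_fin channel_ge0.
apply: (le_mean _ p_distr) => x _; rewrite -EFinM lee_fin /trunc_lo.
case: ifP => Wx; last by rewrite expr0n mul0r mulr_ge0 ?(ltW C_gt0) ?channel_ge0.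
have := w0 y; rewrite le_eqVlt => /predU1P[<-|wy].
  by rewrite invr0 mulr0 mulr_ge0 ?(ltW C_gt0) ?channel_ge0.
by rewrite ler_pdivrMr// mulrAC expr2 ler_wpM2r ?channel_ge0.
Qed.

Lemma delta_fineK : (fine (delta W p C))%:E = delta W p C.
Proof.
rewrite fineK// fin_real// (lt_le_trans (ltNyr 0) delta_ge0)/=.
by rewrite (le_lt_trans delta_le1) ?ltry.
Qed.

Lemma delta'_fineK : (fine (delta' W p C))%:E = delta' W p C.
Proof.
rewrite fineK// fin_real// (lt_le_trans (ltNyr 0) delta'_ge0)/=.
by rewrite (le_lt_trans delta'_le) ?ltry.
Qed.

Lemma mean_trunc_lo_sqr y : mean (fun x => (trunc_lo x y ^+ 2)%:E) =
  (rmean p (fun x => trunc_lo x y ^+ 2))%:E.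
Proof.
apply: (rmean_bounded _ p_distr) => x; rewrite sqr_ge0/= expr_le1//.
  by case/andP: (trunc_lo01 x y).
exact: trunc_lo_ge0.
Qed.

Lemma imean_trunc_lo_deviation n a y : (0 < n)%N -> 0 < a ->
  (imean n (fun s => `|n%:R^-1 * ssum (trunc_lo ^~ y) s - mass_lo y|%:E) <=
   (2 * n%:R * a)^-1%:E * mean (fun x => (trunc_lo x y ^+ 2 / w y)%:E) +
   (a / 2)%:E * (w y)%:E)%E.
Proof.
move=> n0 a0; have nR0 : 0 < n%:R :> R by rewrite ltr0n.
(* If [w y = 0], the truncation leaves only entries [W x y <= 0], so the deviation vanishes for
   every list. *)
have := output_ge0 y; rewrite le_eqVlt => /predU1P[w0|w0].
  have lo0 x : trunc_lo x y = 0.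
    by apply/eqP; rewrite eq_le trunc_lo_ge0 andbT /trunc_lo -w0 mulr0; case: ifP.
  have -> : mass_lo y = 0.
    apply: EFin_inj; rewrite -mean_trunc_lo -[RHS](mean_cst _ p_distr 0)//.
    by apply: (eq_mean _ p_distr) => x _; rewrite /= lo0.
  rewrite (@le_trans _ _ 0%E)//; last first.
    rewrite adde_ge0// ?mule_ge0 ?lee_fin ?divr_ge0 ?output_ge0 ?(ltW a0)//.
      by rewrite invr_ge0 !mulr_ge0// ltW.
    apply: (mean_ge0 _ p_distr) => x.
    by rewrite lee_fin divr_ge0 ?sqr_ge0 ?output_ge0.
  rewrite -[leRHS](imean_cst _ p_distr n 0)//; apply: (le_imean _ p_distr) => s _ _.
  by rewrite /ssum big1// mulr0 subr0 normr0.
(* The parameter [b = a * w y] is proportional to the output mass, with one factor [a] for all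
   [y]. *)
have h := imean_deviation _ p_distr n _ _ _ (a * w y) n0 (trunc_lo_ge0 ^~ y)
  (mulr_gt0 a0 w0) (mean_trunc_lo y) (mean_trunc_lo_sqr y).
apply: (le_trans h).
have -> : mean (fun x => (trunc_lo x y ^+ 2 / w y)%:E) =
    ((w y)^-1%:E * (rmean p (fun x => trunc_lo x y ^+ 2))%:E)%E.
  rewrite -mean_trunc_lo_sqr -(meanZl _ p_distr) ?invr_ge0 ?output_ge0//.
    by apply: (eq_mean _ p_distr) => x _; rewrite -EFinM mulrC.
  by move=> x; rewrite lee_fin sqr_ge0.
rewrite -!EFinM -EFinD lee_fin le_eqVlt; apply/orP; left; apply/eqP.
by field; rewrite !gt_eqF.
Qed.

Lemma imean_output_deviation n a y : (0 < n)%N -> 0 < a ->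
  (imean n (fun s => `|n%:R^-1 * ssum (W ^~ y) s - w y|%:E) <=
   2%:E * (mass_hi y)%:E +
   ((2 * n%:R * a)^-1%:E * mean (fun x => (trunc_lo x y ^+ 2 / w y)%:E) +
    (a / 2)%:E * (w y)%:E))%E.
Proof.
move=> n0 a0; have nR0 : 0 < n%:R :> R by rewrite ltr0n.
have nV0 : 0 <= n%:R^-1 :> R by rewrite invr_ge0.
have S0 s : 0 <= ssum (trunc_hi ^~ y) s by apply: ssum_ge0 => x; exact: trunc_hi_ge0.
(* The upper part is bounded by the sum of its sample mean and its mean, each averaging to
   [mass_hi y]: hence the factor 2 before [delta]. *)
apply: (@le_trans _ _ (imean n (fun s => (n%:R^-1%:E * (ssum (trunc_hi ^~ y) s)%:E +
   (mass_hi y)%:E) + `|n%:R^-1 * ssum (trunc_lo ^~ y) s - mass_lo y|%:E)%E)).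
  apply: (le_imean _ p_distr) => s _ _; rewrite -EFinM -!EFinD lee_fin massD.
  have -> : ssum (W ^~ y) s = ssum (trunc_hi ^~ y) s + ssum (trunc_lo ^~ y) s.
    by rewrite /ssum -big_split; apply: eq_bigr => x _; exact: truncD.
  rewrite mulrDr opprD addrACA (le_trans (ler_normD _ _))// lerD2r.
  rewrite (le_trans (ler_normB _ _))// !ger0_norm ?mass_hi_ge0//.
  by rewrite mulr_ge0.
have h1 s : (0 <= n%:R^-1%:E * (ssum (trunc_hi ^~ y) s)%:E)%E.
  by rewrite mule_ge0// lee_fin.
have h2 : (0 <= (mass_hi y)%:E)%E by rewrite lee_fin mass_hi_ge0.
rewrite !(imeanD _ p_distr)//; last by move=> s; rewrite adde_ge0.
rewrite (imeanZl _ p_distr)//.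
rewrite (imean_ssum _ p_distr _ _ (mass_hi y))//; last 2 first.
- by move=> x; exact: trunc_hi_ge0.
- exact: mean_trunc_hi.
rewrite (imean_cst _ p_distr) ?mass_hi_ge0//.
rewrite leeD ?imean_trunc_lo_deviation//.
by rewrite -!EFinM -EFinD lee_fin mulKf ?gt_eqF// mulr_natl mulr2n.
Qed.

Lemma imean_eps n a : (0 < n)%N -> 0 < a ->
  (imean n (fun s => \esum_(y in [set: Y])
      `|n%:R^-1 * ssum (W ^~ y) s - w y|%:E) <=
   (2 * fine (delta W p C) +
     (fine (delta' W p C) / n%:R / (2 * a) + a / 2))%:E)%E.
Proof.
move=> n0 a0; have nR0 : 0 < n%:R :> R by rewrite ltr0n.
have [_ w1] := output_distr.
rewrite (imean_esum _ p_distr); last by move=> s y; rewrite lee_fin.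
apply: le_trans (le_esum _) _.
  by move=> y _; exact: (imean_output_deviation n a y n0 a0).
have c0 : 0 <= (2 * n%:R * a)^-1 by rewrite invr_ge0 !mulr_ge0// ltW.
have m0 y : (0 <= mean (fun x => (trunc_lo x y ^+ 2 / w y)%:E))%E.
  apply: (mean_ge0 _ p_distr) => x.
  by rewrite lee_fin divr_ge0 ?sqr_ge0 ?output_ge0.
have h0 y : (0 <= (mass_hi y)%:E)%E by rewrite lee_fin mass_hi_ge0.
have w0 y : (0 <= (w y)%:E)%E by rewrite lee_fin output_ge0.
rewrite !esumD ?esumZl//; try by move=> y _;
  rewrite ?adde_ge0 ?mule_ge0// lee_fin// divr_ge0// ltW.
  rewrite -delta_esum -delta'_esum -delta_fineK -delta'_fineK.
  rewrite -[X in ((a / 2)%:E * X)%E]/(psum w) w1 mule1 -!EFinM -!EFinD lee_fin.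
  rewrite le_eqVlt; apply/orP; left; apply/eqP.
  by field; rewrite !gt_eqF.
by rewrite divr_ge0// ltW.
Qed.

Lemma eps_code_ex n : (0 < n)%N -> exists Psi : 'I_n -> X,
  (eps_code W p Psi <=
    (2 * fine (delta W p C) + Num.sqrt (fine (delta' W p C) / n%:R))%:E)%E.
Proof.
move=> n0; have nR0 : 0 < n%:R :> R by rewrite ltr0n.
have v0 : 0 <= fine (delta' W p C) / n%:R.
  by rewrite divr_ge0// -lee_fin delta'_fineK delta'_ge0.
have : (imean n (fun s => \esum_(y in [set: Y])
      `|n%:R^-1 * ssum (W ^~ y) s - w y|%:E) <=
    (2 * fine (delta W p C) + Num.sqrt (fine (delta' W p C) / n%:R))%:E)%E.
  have := fun a => imean_eps n a n0; move: (_ / n%:R) v0 => v v0 h.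
  move: v0; rewrite le_eqVlt => /predU1P[v0|v0].
    (* For [v = 0] the optimal [a] would be 0; instead [a = 2 e] leaves an arbitrarily small error
       [e]. *)
    rewrite -v0 sqrtr0 addr0; apply/lee_addgt0Pr => e e0.
    rewrite -EFinD; have := h (2 * e); rewrite -v0 mul0r add0r mulrC mulfK//.
    by rewrite mulrC; apply; rewrite mulr_gt0.
  have q0 : 0 < Num.sqrt v by rewrite sqrtr_gt0.
  (* The minimum of [v / (2 a) + a / 2] is reached at [a = sqrt v]. *)
  apply: le_trans (h _ q0) _; rewrite lee_fin lerD2l -{1}(sqr_sqrtr (ltW v0)).
  rewrite le_eqVlt; apply/orP; left; apply/eqP.
  by field; rewrite gt_eqF.
move=> /(imean_ex _ p_distr)[s|s [_ hs]].
  by apply: esum_ge0 => y _; rewrite lee_fin.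
exists (tnth s); apply: le_trans hs; apply: le_esum => y _.
by rewrite code_out_tnth.
Qed.

End Truncation.

End Channel.

(** * Divergence *)

Section Divergence.
Context {R : realType} {X Y : countType} (W : X -> Y -> R) (p : X -> R).
Hypotheses (W_channel : is_channel W) (p_distr : is_distr p).
Hypothesis Y_finite : finite_set [set: Y].
Local Notation mean := (mean p).
Local Notation imean := (imean p).
Local Notation w := (Wp W p).

Let W0 := channel_ge0 W W_channel.
Let w0 := output_ge0 W p W_channel p_distr.

Definition code_kl n (s : seq X) (y : Y) : R :=
  if w y == 0 then 0 else kl_term (n%:R^-1 * ssum (W ^~ y) s) (w y).

Lemma code_kl_ge0 n s y : 0 <= code_kl n s y.
Proof.
rewrite /code_kl; case: eqVneq => // wy; apply: kl_term_ge0.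
  by rewrite mulr_ge0 ?invr_ge0//; apply: ssum_ge0 => x; exact: W0.
by rewrite lt_neqAle eq_sym wy w0.
Qed.

Lemma distr_fsum (q : Y -> R) : is_distr q -> \sum_(y \in [set: Y]) q y = 1.
Proof.
move=> [q0 q1]; apply: EFin_inj; rewrite -fsumEFin// -esum_fset//.
by move=> y _; rewrite lee_fin.
Qed.

(** The corrections [w - q] cancel in total, both distributions having mass 1, and the infinite case
    of [KL] does not occur since [q] vanishes wherever [w] does. *)
Lemma D_code_esum n (s : n.-tuple X) : (0 < n)%N -> all (fun x => 0 < p x) s ->
  D_code W p (tnth s) = \esum_(y in [set: Y]) (code_kl n s y)%:E.
Proof.
move=> n0 ps; have nR0 : 0 < n%:R :> R by rewrite ltr0n.
rewrite esum_fset//; last by move=> y _; rewrite lee_fin code_kl_ge0.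
pose q y := n%:R^-1 * ssum (W ^~ y) s.
have q_w y : w y = 0 -> q y = 0.
  move=> wy; rewrite /q /ssum big_seq big1 ?mulr0// => x xs.
  apply/eqP; rewrite eq_le W0 andbT leNgt; apply/negP => Wx.
  have px : 0 < p x by move/allP: ps; apply.
  by have := output_gt0 W p W_channel p_distr x y px Wx; rewrite wy ltxx.
have q1 : \sum_(y \in [set: Y]) q y = 1.
  rewrite -mulr_fsumr /ssum fsbig_finite// exchange_big/=.
  rewrite (eq_bigr (fun=> 1)) => [|x _].
    by rewrite big_const_seq count_predT iter_addr_0 size_tuple mulVf// gt_eqF.
  by rewrite -fsbig_finite// distr_fsum.
have w1 := distr_fsum _ (output_distr W p W_channel p_distr).
have -> : \sum_(y \in [set: Y]) (code_kl n s y)%:E =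
    (\sum_(y \in [set: Y]) (q y * ln (q y / w y)))%:E.
  rewrite fsumEFin//; congr _%:E.
  transitivity (\sum_(y \in [set: Y]) (q y * ln (q y / w y)) -
     \sum_(y \in [set: Y]) q y + \sum_(y \in [set: Y]) w y); last first.
    by rewrite q1 w1 subrK.
  rewrite !fsbig_finite// -sumrB -big_split; apply: eq_bigr => y _ /=.
  rewrite /code_kl /kl_term -/(q y); case: eqVneq => // wy.
  by rewrite q_w// wy mul0r subr0 addr0.
rewrite -fsumEFin// /D_code /KL; apply: eq_fsbigr => y _.
rewrite code_out_tnth -/(q y).
case: eqVneq => [->|qy]; first by rewrite mul0r.
by case: eqVneq => // /q_w /eqP; rewrite (negbTE qy).
Qed.

(** [imean_kl] at each output followed by random coding. Both divergence bounds come from a choice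
    of the majorant [a] of the logarithm. *)
Lemma D_code_ex n (a : X -> Y -> R) b : (0 < n)%N ->
  (forall x y, 0 <= a x y) ->
  (forall x y, 0 < p x -> 0 < W x y ->
    ln ((W x y + (n%:R - 1) * w y) / (n%:R * w y)) <= a x y) ->
  (\esum_(y in [set: Y]) mean (fun x => (W x y * a x y)%:E) <= b%:E)%E ->
  exists Psi : 'I_n -> X, (D_code W p Psi <= b%:E)%E.
Proof.
move=> n0 a0 Wa hb.
have : (imean n (fun s => \esum_(y in [set: Y]) (code_kl n s y)%:E) <= b%:E)%E.
  rewrite (imean_esum _ p_distr); last by move=> s y; rewrite lee_fin code_kl_ge0.
  apply: le_trans hb; apply: le_esum => y _; rewrite /code_kl.
  case: eqVneq => wy.
    rewrite (imean_cst _ p_distr)// (mean_ge0 _ p_distr)// => x.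
    by rewrite lee_fin mulr_ge0.
  apply: (imean_kl _ p_distr n (W ^~ y) (a ^~ y) (w y)) => //.
  - by rewrite lt_neqAle eq_sym wy w0.
  - by move=> x; exact: Wa.
  - exact: mean_channel.
move=> /(imean_ex _ p_distr)[s|s [ps hs]].
  by apply: esum_ge0 => y _; rewrite lee_fin code_kl_ge0.
by exists (tnth s); rewrite D_code_esum.
Qed.

Lemma esum_meanW : (\esum_(y in [set: Y]) mean (fun x => (W x y)%:E) = 1)%E.
Proof.
have [_ <-] := output_distr W p W_channel p_distr.
by apply: eq_esum => y _; exact: mean_channel.
Qed.

(** * Divergence bound by [phi], with [s = - t] *)

Section Renyi.
Variable s : R.
Hypothesis s_itv : 0 < s < 1.

Let s0 : 0 < s. Proof. by case/andP: s_itv. Qed.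
Let s1 : s < 1. Proof. by case/andP: s_itv. Qed.

(** The inner sum of [phi], since [1 / (1 + t) = (1 - s)^-1]. *)
Definition tilted_mean y : R := rmean p (fun x => W x y `^ (1 - s)^-1).

Lemma mean_tilted y :
  mean (fun x => (W x y `^ (1 - s)^-1)%:E) = (tilted_mean y)%:E.
Proof.
apply: (rmean_bounded _ p_distr) => x; rewrite powR_ge0/=.
have := W0 x y; rewrite le_eqVlt => /predU1P[<-|Wx].
  by rewrite powR0// invr_eq0 subr_eq0 gt_eqF.
rewrite -[leRHS](powRr0 (W x y)) ger_powR//; first by rewrite Wx channel_le1.
by rewrite invr_ge0 subr_ge0 ltW.
Qed.

(** A vanishing sum of non-negative terms would force [W x y = 0] on the support of [p], hence
    [w y = 0]. *)
Lemma tilted_mean_gt0 y : 0 < w y -> 0 < tilted_mean y.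
Proof.
move=> wy; apply: contrapT => /negP; rewrite -leNgt => Z0.
have : (w y)%:E = 0%:E.
  rewrite -mean_channel// -[RHS](mean_cst _ p_distr 0)//.
  apply: (eq_mean _ p_distr) => x px /=; congr _%:E; apply/eqP.
  rewrite eq_le W0 andbT leNgt; apply/negP => Wx.
  have : ((p x)%:E * (W x y `^ (1 - s)^-1)%:E <= 0%:E)%E.
    rewrite -lee_fin -mean_tilted in Z0; apply: le_trans Z0.
    apply: (le_esum_term (fun x => ((p x)%:E * (W x y `^ (1 - s)^-1)%:E)%E)) => z.
    by case: p_distr => p0 _; rewrite -EFinM lee_fin mulr_ge0// powR_ge0.
  by rewrite -EFinM lee_fin leNgt mulr_gt0// powR_gt0.
by move=> [] wy0; rewrite wy0 ltxx in wy.
Qed.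

Lemma mean_powR_le n y : (0 < n)%N ->
  (mean (fun x => (W x y * (W x y / (n%:R * w y)) `^ s)%:E) <=
   (n%:R `^ (- s) * tilted_mean y `^ (1 - s))%:E)%E.
Proof.
move=> n0; have nR0 : 0 < n%:R :> R by rewrite ltr0n.
have := w0 y; rewrite le_eqVlt => /predU1P[wy|wy].
  apply: (@le_trans _ _ (mean (fun=> 0%:E))).
    apply: (le_mean _ p_distr) => x _.
    by rewrite -wy mulr0 invr0 mulr0 powR0 ?mulr0 ?gt_eqF.
  by rewrite (mean_cst _ p_distr)// lee_fin mulr_ge0 ?powR_ge0.
have Z0 := tilted_mean_gt0 _ wy.
set Z := tilted_mean y in Z0 *; set K := n%:R `^ (- s) * Z `^ (1 - s).
have K0 : 0 <= K by rewrite mulr_ge0 ?powR_ge0.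
have c1 : 0 <= K * ((1 - s) / Z) by rewrite mulr_ge0// divr_ge0 ?subr_ge0 ?(ltW s1) ?(ltW Z0).
have c2 : 0 <= K * (s / w y) by rewrite mulr_ge0// divr_ge0 ?(ltW s0).
(* Hoelder's inequality through Young's: [W = A^(1 - s)] with [A] the tilted entry, and [A / Z] and
   [W / w] both have mean 1, so the weights [1 - s] and [s] add up to 1. *)
apply: (@le_trans _ _ (mean (fun x =>
    (K * ((1 - s) / Z))%:E * (W x y `^ (1 - s)^-1)%:E +
    (K * (s / w y))%:E * (W x y)%:E)%E)).
  apply: (le_mean _ p_distr) => x _; rewrite -!EFinM -EFinD lee_fin.
  set A := W x y `^ (1 - s)^-1.
  have A0 : 0 <= A by exact: powR_ge0.
  have := powR_young (A / Z) (W x y / w y) s.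
  rewrite !divr_ge0// ?(ltW Z0)// => /(_ isT isT s_itv) h.
  have -> : K * ((1 - s) / Z) * A + K * (s / w y) * W x y =
      K * ((1 - s) * (A / Z) + s * (W x y / w y)) by ring.
  apply: le_trans (ler_wpM2l K0 h).
  have -> : W x y / (n%:R * w y) = n%:R^-1 * (W x y / w y).
    by field; rewrite !gt_eqF.
  rewrite (@powRM _ n%:R^-1) ?invr_ge0 ?divr_ge0//.
  rewrite (@powRM _ A) ?invr_ge0 ?(ltW Z0)// /A -powRrM mulVf ?subr_eq0 ?gt_eqF//.
  rewrite powRr1// /K -(powR_inv1 (ltW Z0)) -(powR_inv1 (ltW nR0)) -!powRrM.
  rewrite !mulN1r (powRN Z).
  rewrite le_eqVlt; apply/orP; left; apply/eqP.
  by field; rewrite gt_eqF// powR_gt0.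
rewrite (meanD _ p_distr); [|by move=> x; rewrite -EFinM lee_fin mulr_ge0 ?powR_ge0..].
rewrite !(meanZl _ p_distr)//; [|by move=> x; rewrite lee_fin ?powR_ge0..].
rewrite mean_tilted -[X in (_ + _ * X)%E]/(mean (EFin \o W ^~ y)) mean_channel//.
rewrite -!EFinM -EFinD lee_fin le_eqVlt; apply/orP; left; apply/eqP.
by rewrite -/Z; field; rewrite !gt_eqF.
Qed.

Lemma D_code_renyi n K : (0 < n)%N -> 0 <= K ->
  n%:R `^ (- s) * (\sum_(y \in [set: Y]) tilted_mean y `^ (1 - s)) <= K ->
  exists Psi : 'I_n -> X, (D_code W p Psi <= (ln (1 + K) / s)%:E)%E.
Proof.
move=> n0 K0 hK; have nR0 : 0 < n%:R :> R by rewrite ltr0n.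
pose v x y := (W x y / (n%:R * w y)) `^ s.
have u0 x y : 0 <= W x y / (n%:R * w y) by rewrite divr_ge0 ?mulr_ge0 ?(ltW nR0).
(* Raising [(n - 1) / n] to 1 inside the logarithm makes the majorant non-negative. *)
pose a x y := ln (1 + W x y / (n%:R * w y)).
have a0 x y : 0 <= a x y by rewrite ln_ge0// lerDl.
have Wv0 x y : 0 <= W x y * v x y by rewrite mulr_ge0// powR_ge0.
have K1 : 0 < 1 + K by lra.
have L0 : 0 <= ln (1 + K) by rewrite ln_ge0// lerDl.
apply: (D_code_ex n a) => // [x y px Wx|].
  have wy := output_gt0 W p W_channel p_distr x y px Wx.
  have nw0 : 0 < n%:R * w y by rewrite mulr_gt0.
  have n1w : 0 <= (n%:R - 1) * w y by rewrite mulr_ge0// subr_ge0 ler1n.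
  rewrite ler_ln ?posrE ?divr_gt0 ?ltr_wpDr//.
  by rewrite -[X in _ <= X + _](mulfV (lt0r_neq0 nw0)) -mulrDl ler_pM2r ?invr_gt0//; lra.
have V : (\esum_(y in [set: Y]) mean (fun x => (W x y * v x y)%:E) <= K%:E)%E.
  apply: (@le_trans _ _ (\esum_(y in [set: Y])
      (n%:R `^ (- s) * tilted_mean y `^ (1 - s))%:E)%E).
    by apply: le_esum => y _; exact: mean_powR_le.
  rewrite esum_fset//; last by move=> y _; rewrite lee_fin mulr_ge0 ?powR_ge0.
  by rewrite fsumEFin// -mulr_fsumr lee_fin.
have c0 : 0 <= s^-1 by rewrite invr_ge0 ltW.
have c1 : 0 <= s^-1 * (ln (1 + K) + (1 + K)^-1).
  by rewrite mulr_ge0// addr_ge0// invr_ge0 ltW.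
have c2 : 0 <= s^-1 * (1 + K)^-1 by rewrite mulr_ge0// invr_ge0 ltW.
(* Jensen's inequality in tangent form: [ln (1 + v)] is bounded by the tangent of [ln] at [1 + K].
   Its constant [- 1] is moved to the left as [s^-1 * W], to avoid negative terms. *)
have : (\esum_(y in [set: Y]) mean (fun x => (W x y * a x y)%:E + s^-1%:E * (W x y)%:E) <=
    \esum_(y in [set: Y]) mean (fun x =>
      (s^-1 * (ln (1 + K) + (1 + K)^-1))%:E * (W x y)%:E +
      (s^-1 * (1 + K)^-1)%:E * (W x y * v x y)%:E))%E.
  apply: le_esum => y _; apply: (le_mean _ p_distr) => x _.
  rewrite -!EFinM -!EFinD lee_fin.
  have v0 : 0 <= v x y by exact: powR_ge0.
  have v1 : 0 < 1 + v x y by lra.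
  have h1 : a x y <= ln (1 + v x y) / s by rewrite ln1D_le_powR// s0 ltW.
  have h2 := ln_tangent _ _ K1 v1.
  have h3 : ln (1 + v x y) / s <= (ln (1 + K) + ((1 + v x y) / (1 + K) - 1)) / s.
    by rewrite ler_pM2r ?invr_gt0.
  have := ler_wpM2l (W0 x y) (le_trans h1 h3); rewrite -(lerD2r (s^-1 * W x y)).
  move=> /le_trans; apply; rewrite le_eqVlt; apply/orP; left; apply/eqP.
  by field; rewrite !gt_eqF.
have hW x y : (0 <= (W x y)%:E)%E by rewrite lee_fin.
have hWa x y : (0 <= (W x y * a x y)%:E)%E by rewrite lee_fin mulr_ge0.
have hWv x y : (0 <= (W x y * v x y)%:E)%E by rewrite lee_fin.
rewrite (eq_esum (b := fun y => (mean (fun x => (W x y * a x y)%:E) +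
    s^-1%:E * mean (fun x => (W x y)%:E))%E)); last first.
  move=> y _; rewrite (meanD _ p_distr)//; last by move=> x; rewrite mule_ge0.
  by rewrite (meanZl _ p_distr).
rewrite [leRHS](eq_esum (b := fun y =>
    ((s^-1 * (ln (1 + K) + (1 + K)^-1))%:E * mean (fun x => (W x y)%:E) +
     (s^-1 * (1 + K)^-1)%:E * mean (fun x => (W x y * v x y)%:E))%E)); last first.
  move=> y _; rewrite (meanD _ p_distr); [|by move=> x; rewrite mule_ge0..].
  by rewrite !(meanZl _ p_distr).
have mW y : (0 <= mean (fun x => (W x y)%:E))%E by exact: (mean_ge0 _ p_distr).
have mWa y : (0 <= mean (fun x => (W x y * a x y)%:E))%E by exact: (mean_ge0 _ p_distr).
have mWv y : (0 <= mean (fun x => (W x y * v x y)%:E))%E by exact: (mean_ge0 _ p_distr).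
rewrite !esumD; try by move=> y _; rewrite ?mule_ge0.
rewrite !esumZl// esum_meanW !mule1 -leeBrDr// => /le_trans; apply.
rewrite leeBlDr//; apply: (@le_trans _ _ ((s^-1 * (ln (1 + K) + (1 + K)^-1))%:E +
  (s^-1 * (1 + K)^-1)%:E * K%:E)%E).
  by rewrite leeD2l// lee_wpmul2l.
rewrite -!EFinM -!EFinD lee_fin le_eqVlt; apply/orP; left; apply/eqP.
by field; rewrite !gt_eqF.
Qed.

End Renyi.

Lemma D_code_phi_ex n t : (0 < n)%N -> -1 < t < 0 ->
  exists Psi : 'I_n -> X,
    (D_code W p Psi <= (ln (1 + n%:R `^ t * expR (phi W p t)) / - t)%:E)%E.
Proof.
move=> n0 /andP[t1 t0].
have s_itv : 0 < - t < 1 by apply/andP; split; lra.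
apply: (D_code_renyi _ s_itv) => //.
rewrite !opprK ler_wpM2l ?powR_ge0//.
have tilted y : fine (psum (fun x => p x * W x y `^ (1 / (1 + t)))) =
    tilted_mean (- t) y.
  rewrite /tilted_mean opprK; apply: (congr1 fine).
  by apply: eq_esum => x _; rewrite EFinM div1r.
have -> : phi W p t = ln (\sum_(y \in [set: Y]) tilted_mean (- t) y `^ (1 + t)).
  apply: (congr1 (@ln R)); apply: eq_fsbigr => y _.
  by rewrite tilted.
set Z := \sum_(y \in _) _; have : 0 <= Z by apply: fsumr_ge0 => y _; exact: powR_ge0.
(* [expR (ln Z) = Z] holds for [Z > 0]; for [Z = 0] the inequality wanted is only non-negativity of
   [expR]. *)
rewrite le_eqVlt => /predU1P[<-|Z0]; first exact: expR_ge0.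
by rewrite lnK.
Qed.

(** * Divergence bound by [delta] and [delta'] *)

Section Entropy.
Variable C : R.
Hypothesis C_gt0 : 0 < C.
Local Notation mu := (mass_hi W p C).

Let mu0 := mass_hi_ge0 W p W_channel p_distr C.

Lemma mass_hi_le y : mu y <= w y.
Proof. by rewrite (massD W p W_channel p_distr C) lerDl mass_lo_ge0. Qed.

Lemma delta_fsum : fine (delta W p C) = \sum_(y \in [set: Y]) mu y.
Proof.
rewrite (delta_esum W p W_channel p_distr C) esum_fset ?fsumEFin//.
by move=> y _; rewrite lee_fin mu0.
Qed.

(** Since [mu <= w], the left side is at most the entropy of [mu], which is largest when the mass
    [d] is spread uniformly. *)
Lemma cross_entropy_le (d := fine (delta W p C)) :
  \sum_(y \in [set: Y]) mu y * - ln (w y) <=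
  eta_ent d + d * ln (#|` fset_set [set: Y]|)%fset%:R.
Proof.
have dE : d = \sum_(y <- fset_set [set: Y]) mu y by rewrite /d delta_fsum fsbig_finite.
rewrite fsbig_finite//; set F := fset_set [set: Y] in dE *.
have : 0 <= d by rewrite dE sumr_ge0.
rewrite le_eqVlt => /predU1P[d0|d0].
  rewrite -d0 /eta_ent oppr0 !mul0r addr0 big_seq big1// => y yF.
  suff -> : mu y = 0 by rewrite mul0r.
  apply/eqP; rewrite eq_le mu0 andbT d0 dE (big_rem y)//= lerDl.
  exact: sumr_ge0.
have N0 : 0 < (#|` F|)%fset%:R :> R.
  rewrite ltr0n lt0n; apply: contraTneq d0 => /eqP.
  by rewrite cardfs_eq0 dE => /eqP ->; rewrite big_nil ltxx.
set N := _%:R in N0 *; pose b := d / N.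
have b0 : 0 < b by rewrite divr_gt0.
(* Gibbs' inequality against the uniform density [b = d / N]; the added terms [mu y] and [b] both
   sum to [d]. *)
have : \sum_(y <- F) (mu y * - ln (w y) + mu y) <= \sum_(y <- F) (mu y * - ln b + b).
  apply: ler_sum => y _.
  have := mu0 y; rewrite le_eqVlt => /predU1P[<-|my].
    by rewrite !mul0r !add0r ltW.
  have wy : 0 < w y := lt_le_trans my (mass_hi_le y).
  have h1 : ln (mu y) <= ln (w y) by rewrite ler_ln ?posrE// mass_hi_le.
  have h2 := ln_tangent _ _ my b0.
  have : mu y * (- ln (w y) + 1) <= mu y * (- ln b + b / mu y).
    by rewrite ler_pM2l//; lra.
  have -> : mu y * (- ln b + b / mu y) = mu y * - ln b + b.
    by field; rewrite gt_eqF.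
  lra.
rewrite !big_split/= -mulr_suml -dE big_const_seq count_predT iter_addr_0.
rewrite -[b *+ _]mulr_natr -/N /b divfK ?gt_eqF// ln_div ?posrE// /eta_ent.
lra.
Qed.

Lemma D_code_delta_ex n : (0 < n)%N -> exists Psi : 'I_n -> X,
  (D_code W p Psi <=
    (eta_ent (fine (delta W p C))
     + fine (delta W p C) * ln (#|` fset_set [set: Y]|)%fset%:R
     + fine (delta' W p C) / n%:R)%:E)%E.
Proof.
move=> n0; have nR0 : 0 < n%:R :> R by rewrite ltr0n.
have nR1 : 1 <= n%:R :> R by rewrite ler1n.
have lw0 y : 0 <= - ln (w y) by rewrite oppr_ge0 ln_le0// output_le1.
(* Below the level, [ln r <= r - 1] gives [W / (n w) - 1 / n]; above it, [W <= 1] and [w <= 1] bound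
   the numerator by [n], hence the ratio by [1 / w]. *)
pose a x y := if W x y <= C * w y then W x y / (n%:R * w y) else - ln (w y).
apply: (D_code_ex n a) => // [x y|x y px Wx|].
- by rewrite /a; case: ifP => // _; rewrite divr_ge0 ?mulr_ge0 ?(ltW nR0).
- have wy := output_gt0 W p W_channel p_distr x y px Wx.
  have nw0 : 0 < n%:R * w y by rewrite mulr_gt0.
  have n1w : 0 <= (n%:R - 1) * w y by rewrite mulr_ge0// subr_ge0.
  have r0 : 0 < (W x y + (n%:R - 1) * w y) / (n%:R * w y).
    by rewrite divr_gt0// ltr_wpDr.
  rewrite /a; case: ifP => _.
    apply: le_trans (ln_le_subr1 _ r0) _.
    rewrite -subr_ge0 (_ : _ - _ = n%:R^-1) ?invr_ge0 ?(ltW nR0)//.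
    by field; rewrite !gt_eqF.
  rewrite -lnV ?posrE// ler_ln ?posrE ?invr_gt0// ler_pdivrMr// mulrCA mulVf ?gt_eqF//.
  have : (n%:R - 1) * w y <= n%:R - 1 by rewrite ler_piMr ?subr_ge0// output_le1.
  have := channel_le1 W W_channel x y; lra.
have lo0 x y : (0 <= (trunc_lo W p C x y ^+ 2 / w y)%:E)%E.
  by rewrite lee_fin divr_ge0 ?sqr_ge0.
have hi0 x y : (0 <= (trunc_hi W p C x y)%:E)%E.
  by rewrite lee_fin trunc_hi_ge0.
have mlo0 y : (0 <= mean (fun x => (trunc_lo W p C x y ^+ 2 / w y)%:E))%E.
  exact: (mean_ge0 _ p_distr).
have nV0 : 0 <= n%:R^-1 :> R by rewrite invr_ge0.
rewrite (eq_esum (b := fun y => ((mu y * - ln (w y))%:E +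
   n%:R^-1%:E * mean (fun x => (trunc_lo W p C x y ^+ 2 / w y)%:E))%E)); last first.
  (* [W * a] splits along the truncation: the upper part carries [- ln w] and will give the cross
     entropy, the lower part [W^2 / (n w)] will give [delta' / n]. *)
  move=> y _; transitivity (mean (fun x =>
      (- ln (w y))%:E * (trunc_hi W p C x y)%:E +
      n%:R^-1%:E * (trunc_lo W p C x y ^+ 2 / w y)%:E)%E).
    apply: (eq_mean _ p_distr) => x _; rewrite -!EFinM -EFinD; congr _%:E.
    rewrite /a /trunc_hi /trunc_lo; case: leP => _.
      by rewrite mulr0 add0r invfM; ring.
    by rewrite expr0n mul0r mulr0 addr0 mulrC.
  rewrite (meanD _ p_distr); [|by move=> x; rewrite mule_ge0// lee_fin..].
  rewrite !(meanZl _ p_distr)//; congr (_ + _)%E.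
  rewrite -[X in (_ * X)%E]/(mean (EFin \o trunc_hi W p C ^~ y)).
  by rewrite (mean_trunc_hi W p W_channel p_distr) -EFinM mulrC.
rewrite esumD; last 2 first.
- by move=> y _; rewrite lee_fin mulr_ge0.
- by move=> y _; rewrite mule_ge0// lee_fin.
rewrite esumZl// -(delta'_esum W p W_channel p_distr) EFinD leeD//.
  rewrite esum_fset// ?fsumEFin ?lee_fin ?cross_entropy_le//.
  by move=> y _; rewrite lee_fin mulr_ge0.
by rewrite mulrC EFinM delta'_fineK.
Qed.

End Entropy.

End Divergence.

Theorem theorem2 (R : realType) (X Y : countType) (W : X -> Y -> R)
  (HW : is_channel W) (M : nat) (C : R) (p : X -> R) :
  (0 < M)%N -> 0 < C -> is_distr p ->
  ((delta' W p C <= C%:E)%E /\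
   exists Psi : 'I_M -> X,
     (eps_code W p Psi <=
        (2 * fine (delta W p C) + Num.sqrt (fine (delta' W p C) / M%:R))%:E)%E)
  /\
  (finite_set [set: Y] ->
     (forall t : R, - (1 / 2) <= t -> t < 0 ->
        exists Psi' : 'I_M -> X,
          (D_code W p Psi' <=
             (ln (1 + (M%:R `^ t) * expR (phi W p t)) / (- t))%:E)%E)
     /\
     exists Psi'' : 'I_M -> X,
       (D_code W p Psi'' <=
          (eta_ent (fine (delta W p C))
           + fine (delta W p C) * ln ((#|` fset_set [set: Y]|)%fset%:R)
           + fine (delta' W p C) / M%:R)%:E)%E).
Proof.
move=> M0 C0 p_distr; split.
  by split; [exact: delta'_le | exact: eps_code_ex].
move=> Y_finite; split; last exact: D_code_delta_ex.
move=> t t12 t0; apply: D_code_phi_ex => //; apply/andP; split => //; lra.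
Qed.
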